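(* Let $f,g:[0,1]\to[0,1]$ be $M$-Lipschitz functions. For a finite graph $G=(V,E)$ without isolated vertices and $x(0)\in\{0,1\}^V$, let $(X(t))_{t\ge 0}$ be the occupancy process on $G$ associated with $f,g$ with $\mathbf P(X(0)=x(0))=1$, and let $(x(t))_{t\ge 0}$ be the deterministic process on $G$ associated with $f,g$ with initial condition $x(0)$. Then for every $v\in V$ and every integer $t\ge0$, $$\left|\mathbf E X_v(t)-x_v(t)\right|\;\le\;\sum_{r=0}^{t-1}\sum_{s=0}^{r-1}\binom{r}{s+1}\left[\sum_{w\in V}\frac{\pi_{v,w}(s)}{\sqrt{\deg(w)}}\right]M^{s+1},$$ where $\pi_{v,w}(s)$ is the probability that a random walker on $G$ starting at $v$ occupies $w$ after $s$ steps. In particular, for every fixed $t\ge 0$, $$\lim_{\delta(G)\to\infty}\left|\mathbf E X_v(t)-x_v(t)\right|=0,$$ where $\delta(G)$ is the minimum degree of $G$; that is, for every $t\ge0$ and $\varepsilon>0$ there is $D$ such that $|\mathbf E X_v(t)-x_v(t)|\le\varepsilon$ for every finite graph $G$ with $\delta(G)\ge D$, every initial condition $x(0)\in\{0,1\}^{V}$ and every vertex $v$ of $G$.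
   Context: For a finite graph $G=(V,E)$ and $v\in V$, $N_v\subseteq V$ is the set of neighbors of $v$ and $\deg v=|N_v|$. For $x\in[0,1]^V$ write $x_{N_v}=(\deg v)^{-1}\sum_{w\in N_v}x_w$. Occupancy process: given $f,g:[0,1]\to[0,1]$, it is a discrete-time Markov process $(X(t))_{t\ge0}$ with values in $\{0,1\}^V$ such that (i) given $X(t)$, each vertex $v$ switches from $1$ to $0$ with probability $f(X_{N_v}(t))$ and from $0$ to $1$ with probability $g(X_{N_v}(t))$; (ii) the random variables $(X_v(t+1))_{v\in V}$ are jointly conditionally independent given $X(t)$. Deterministic process: with $\gamma(x,y)=x(1-f(y))+(1-x)g(y)$ for $x,y\in[0,1]$, it is the sequence in $[0,1]^V$ defined from $x(0)$ by $x_v(t+1)=\gamma(x_v(t),x_{N_v}(t))$ for all $v\in V$, $t\ge0$. The random walk on $G$ is the simple random walk: at each step it moves to a uniformly random neighbor of the current vertex. Sums over empty ranges are zero. *)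

(* Defs.v *)
From HB Require Import structures.
From mathcomp Require Import all_boot all_order all_algebra.
From mathcomp Require Import all_classical all_reals all_analysis.
Set Implicit Arguments.
Unset Strict Implicit.
Unset Printing Implicit Defensive.
Import Order.TTheory GRing.Theory Num.Theory.
Import numFieldNormedType.Exports.
Local Open Scope classical_set_scope.
Local Open Scope ring_scope.

(* Finite simple graphs. *)
Record sgraph := SGraph {
  vertex :> finType;
  adj : rel vertex;
  adj_sym : symmetric adj;
  adj_irr : irreflexive adj }.

Section Graphs.
Variable G : sgraph.

Definition nbr (v : G) : {set G} := [set w | adj v w].

Definition deg (v : G) : nat := #|nbr v|.

Definition no_isolated : Prop := forall v : G, (0 < deg v)%N.

(* Every degree is < #|G|, so the default value of this iterated minimum only
   matters for the empty graph, where it is 0. *)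
Definition min_deg : nat := \big[Order.min/#|G|]_(v : G) deg v.

Lemma min_degP (D : nat) :
  reflect ((D <= #|G|)%N /\ forall v : G, (D <= deg v)%N) (D <= min_deg)%N.
Proof.
rewrite -leEnat; apply: (iffP (bigmin_geP _ _ _ _)) => -[? D_deg]; split=> //.
by move=> v; apply: D_deg.
Qed.

Section Walk.
Variable R : realType.

Definition nbr_mean (x : G -> R) (v : G) : R :=
  (deg v)%:R^-1 * \sum_(w in nbr v) x w.

Definition walk_step (u w : G) : R := (w \in nbr u)%:R / (deg u)%:R.

(* Probability that the simple random walk started at v follows the
   trajectory v, p_0, p_1, ... *)
Fixpoint traj_prob (v : G) (p : seq G) : R :=
  if p is u :: p' then walk_step v u * traj_prob u p' else 1.

(* Probability that the walk started at v is at w after s steps: the total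
   probability of the s-step trajectories from v to w. *)
Definition walk_prob (v w : G) (s : nat) : R :=
  \sum_(p : s.-tuple G | last v p == w) traj_prob v p.

Definition gamma (f g : R -> R) (x y : R) : R :=
  x * (1 - f y) + (1 - x) * g y.

Fixpoint det_process (f g : R -> R) (x0 : G -> R) (t : nat) : G -> R :=
  if t is t'.+1 then
    fun v => gamma f g (det_process f g x0 t' v)
                       (nbr_mean (det_process f g x0 t') v)
  else x0.

End Walk.
End Graphs.

(* The elements of {0,1}^V; true stands for 1. *)
Definition config (G : sgraph) := {ffun G -> bool}.

Definition realc (R : realType) (G : sgraph) (x : config G) : G -> R :=
  fun v => (x v)%:R.

Arguments realc R {G} x.

Section Occupancy.
Context {d : measure_display} {Omega : measurableType d} {R : realType}.
Variable P : probability Omega R.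

(* Conditional probability of A given B; it is only used when P B != 0. *)
Definition cond_prob (A B : set Omega) : R := fine (P (A `&` B)) / fine (P B).

Variable G : sgraph.

(* A {0,1}^V-valued process, given by its coordinates X_v(t). *)
Variable X : nat -> G -> {RV P >-> bool}.

Definition at_vertex (t : nat) (v : G) (b : bool) : set Omega :=
  [set w | X t v w = b].

Definition at_config (t : nat) (x : config G) : set Omega :=
  [set w | forall v : G, X t v w = x v].

Definition history (t : nat) (h : nat -> config G) : set Omega :=
  [set w | forall i : nat, (i <= t)%N -> at_config i (h i) w].

Definition markov_property : Prop :=
  forall (t : nat) (h : nat -> config G) (y : config G),
    P (history t h) != 0%E ->
    cond_prob (at_config t.+1 y) (history t h) =
    cond_prob (at_config t.+1 y) (at_config t (h t)).

Definition switching_probs (f g : R -> R) : Prop :=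
  forall (t : nat) (x : config G), P (at_config t x) != 0%E ->
  forall v : G,
    (x v = true ->
       cond_prob (at_vertex t.+1 v false) (at_config t x) =
       f (nbr_mean (realc R x) v)) /\
    (x v = false ->
       cond_prob (at_vertex t.+1 v true) (at_config t x) =
       g (nbr_mean (realc R x) v)).

Definition cond_indep_updates : Prop :=
  forall (t : nat) (x : config G), P (at_config t x) != 0%E ->
  forall (J : {set G}) (y : config G),
    cond_prob [set w | forall v, v \in J -> at_vertex t.+1 v (y v) w]
              (at_config t x) =
    \prod_(v in J) cond_prob (at_vertex t.+1 v (y v)) (at_config t x).

Definition occupancy_process (f g : R -> R) : Prop :=
  [/\ markov_property, switching_probs f g & cond_indep_updates].

(* E X_v(t), with X_v(t) seen as a {0,1}-valued real random variable. *)
Definition mean_occ (t : nat) (v : G) : \bar R :=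
  ('E_P[fun w => (X t v w)%:R])%E.

End Occupancy.

(* Main.v *)
Require Import Defs.
From HB Require Import structures.
From mathcomp Require Import all_boot all_order all_algebra.
From mathcomp Require Import all_classical all_reals all_analysis.
From mathcomp Require Import ring lra.
Set Implicit Arguments.
Unset Strict Implicit.
Unset Printing Implicit Defensive.
Import Order.TTheory GRing.Theory Num.Theory.
Import numFieldNormedType.Exports.
Local Open Scope classical_set_scope.
Local Open Scope ring_scope.

(** The proof interpolates between the random and the deterministic process and
    then analyses the deterministic flow started from independent Bernoulli
    variables.

    Interpolation. Write D for one step of the deterministic process. Given
    X(k) = x, the coordinates of X(k+1) are independent Bernoulli variables
    with means D(x)_v ([config_probS]). Running the process for k steps and then
    the deterministic flow for r more gives the mean of D^r(X(k))_v; this is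
    E X_v(t) at (k, r) = (t, 0) and x_v(t) at (0, t). Moving one step from the
    process to the flow changes it by at most the largest possible difference
    between the mean of D^r(Y)_v and D^r(q)_v, where Y is a vector of
    independent Bernoulli variables with mean q. Hence the statement follows by
    summing over r < t a bound on that difference.

    The flow from a product measure. The values D^r(Y)_v are not close to
    D^r(q)_v, because Y_v is 0 or 1; but gamma is affine in its first argument,
    so if z_v(r) starts at Y_v and is driven by the deterministic neighbourhood
    averages of the flow from q, then z_v(r) - D^r(q)_v is Y_v - q_v times a
    deterministic factor of modulus at most 1. So z_v(r) has mean D^r(q)_v, and
    the z_w(r) are independent in w: their average over the neighbours of v
    fluctuates by at most deg(v)^(-1/2). Since gamma is 1-Lipschitz in its first
    argument and M-Lipschitz in the second, the mean e_r(v) of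
    |D^r(Y)_v - z_v(r)| satisfies e_0 = 0 and
      e_(r+1)(v) <= e_r(v) + M * ((K e_r)(v) + deg(v)^(-1/2)),
    where K averages over the neighbours, i.e. is the transition operator of the
    random walk ([bern_mean_flow_driven]). The solution of the corresponding
    equation is
      sum_(j < r) (1 + M K)^j M a  =  sum_s 'C(r, s+1) M^(s+1) K^s a
    with a = deg^(-1/2), which is the inner sum of the theorem ([fluctS]).

    When all degrees are at least D, K^s a is at most D^(-1/2), so that the
    bound is a constant depending on t and M times D^(-1/2). *)

(** * Neighbourhood averages and the random walk *)

Section RandomWalk.
Context (R : realType) (G : sgraph).
Implicit Types (x y : G -> R) (v w : G).

Lemma nbr_meanE x v : nbr_mean x v = \sum_w walk_step R v w * x w.
Proof.
rewrite /nbr_mean big_distrr big_mkcond /=; apply: eq_bigr => w _.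
by rewrite /walk_step; case: (w \in nbr v); rewrite ?mul1r // !mul0r.
Qed.

Lemma walk_step_ge0 v w : 0 <= walk_step R v w.
Proof. by rewrite /walk_step divr_ge0. Qed.

Lemma sum_walk_step_le1 v : \sum_w walk_step R v w <= 1.
Proof.
rewrite /walk_step -mulr_suml -natr_sum -big_mkcond sum1_card /=.
by have [->|n0] := eqVneq (deg v) 0; rewrite ?invr0 ?mulr0 // divff ?pnatr_eq0.
Qed.

Lemma nbr_mean_mono {x y} v :
  (forall w, x w <= y w) -> nbr_mean x v <= nbr_mean y v.
Proof.
move=> xy; rewrite !nbr_meanE; apply: ler_sum => w _.
by rewrite ler_wpM2l ?walk_step_ge0.
Qed.

Lemma nbr_mean_le {x} c v : 0 <= c -> (forall w, x w <= c) -> nbr_mean x v <= c.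
Proof.
move=> c0 xc; rewrite (le_trans (nbr_mean_mono v xc)) // nbr_meanE -mulr_suml.
by rewrite -[leRHS]mul1r ler_wpM2r ?sum_walk_step_le1.
Qed.

Lemma nbr_mean_itv01 {x} v : (forall w, 0 <= x w <= 1) -> 0 <= nbr_mean x v <= 1.
Proof.
move=> x01; apply/andP; split; last first.
  by apply: nbr_mean_le => // w; case/andP: (x01 w).
rewrite nbr_meanE sumr_ge0 // => w _; rewrite mulr_ge0 ?walk_step_ge0 //.
by case/andP: (x01 w).
Qed.

Lemma nbr_mean_norm x v : `|nbr_mean x v| <= nbr_mean (fun w => `|x w|) v.
Proof.
rewrite !nbr_meanE (le_trans (ler_norm_sum _ _ _)) //; apply: ler_sum => w _.
by rewrite normrM ger0_norm ?walk_step_ge0.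
Qed.

Lemma nbr_meanB x y v : nbr_mean x v - nbr_mean y v = nbr_mean (fun w => x w - y w) v.
Proof.
by rewrite !nbr_meanE -sumrB; apply: eq_bigr => w _; rewrite mulrBr.
Qed.

Lemma nbr_mean_sum (I : Type) (r : seq I) (F : I -> G -> R) (c : I -> R) v :
  nbr_mean (fun w => \sum_(i <- r) c i * F i w) v = \sum_(i <- r) c i * nbr_mean (F i) v.
Proof.
under eq_bigr do rewrite nbr_meanE mulr_sumr.
rewrite nbr_meanE exchange_big; apply: eq_bigr => w _ /=.
by rewrite mulr_sumr; apply: eq_bigr => i _; rewrite mulrCA.
Qed.

Definition walk_mean (h : G -> R) v s : R := \sum_w walk_prob R v w s * h w.

Lemma walk_mean0 h v : walk_mean h v 0 = h v.
Proof.
rewrite /walk_mean (bigD1 v) //= [X in _ + X]big1 ?addr0 => [|w wv].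
  rewrite /walk_prob (big_pred1 [tuple]) ?mul1r // => p /=.
  by rewrite tuple0 /= !eqxx.
rewrite /walk_prob big_pred0 ?mul0r // => p.
by rewrite tuple0 /= eq_sym (negPf wv).
Qed.

(** Splitting off the first step, rather than the last, makes a step of the walk
    act on functions by [nbr_mean]. *)
Lemma walk_probS v w s :
  walk_prob R v w s.+1 = \sum_u walk_step R v u * walk_prob R u w s.
Proof.
rewrite /walk_prob; under [RHS]eq_bigr do rewrite mulr_sumr.
rewrite pair_big_dep /=.
rewrite (reindex (fun up : G * s.-tuple G => [tuple of up.1 :: up.2])) //=.
exists (fun p : s.+1.-tuple G => (thead p, [tuple of behead p])) => [[u p] _|p _] /=.
  by congr (_, _); apply: val_inj.
by rewrite [RHS]tuple_eta.
Qed.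

Lemma walk_meanS h v s : walk_mean h v s.+1 = nbr_mean (fun u => walk_mean h u s) v.
Proof.
rewrite nbr_meanE /walk_mean; under eq_bigr do rewrite walk_probS mulr_suml.
rewrite exchange_big; apply: eq_bigr => u _ /=.
by rewrite mulr_sumr; apply: eq_bigr => w _; rewrite mulrA.
Qed.

Lemma walk_mean_le {h} c v s : 0 <= c -> (forall w, h w <= c) -> walk_mean h v s <= c.
Proof.
move=> c0 hc; elim: s v => [|s IH] v; first by rewrite walk_mean0.
by rewrite walk_meanS nbr_mean_le.
Qed.

(** The bound on the bias of r steps of the flow started from independent
    Bernoulli variables; the sum over r < t is the bound of the theorem. *)
Definition fluct (M : R) (r : nat) v : R :=
  \sum_(0 <= s < r)
    'C(r, s.+1)%:R * walk_mean (fun w => (Num.sqrt (deg w)%:R)^-1) v s * M ^+ s.+1.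

(** Pascal's rule, using that a further step of the walk is one more
    application of [nbr_mean]. *)
Lemma fluctS M r v :
  fluct M r.+1 v =
    fluct M r v + M * (nbr_mean (fluct M r) v + (Num.sqrt (deg v)%:R)^-1).
Proof.
rewrite /fluct; set a := walk_mean _.
have -> : nbr_mean (fluct M r) v =
    \sum_(0 <= s < r) 'C(r, s.+1)%:R * M ^+ s.+1 * a v s.+1.
  rewrite /fluct -/a.
  have -> : (fun u => \sum_(0 <= s < r) 'C(r, s.+1)%:R * a u s * M ^+ s.+1) =
            (fun u => \sum_(0 <= s < r) ('C(r, s.+1)%:R * M ^+ s.+1) * a u s).
    by apply/funext => u; apply: eq_bigr => s _; rewrite mulrAC.
  rewrite (@nbr_mean_sum _ _ (fun s u => a u s) (fun s => 'C(r, s.+1)%:R * M ^+ s.+1)).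
  by apply: eq_bigr => s _; rewrite /a walk_meanS.
under eq_bigr do rewrite binS natrD mulrDl mulrDl.
rewrite big_split /= big_nat_recr //= bin_small // !mul0r addr0; congr (_ + _).
rewrite big_nat_recl //= bin0 expr1 mul1r /a walk_mean0 addrC mulrDr.
congr (_ + _); last by rewrite mulrC.
by rewrite mulr_sumr; apply: eq_bigr => s _; rewrite -/a exprS; ring.
Qed.

End RandomWalk.

(** * Products of Bernoulli measures *)

Section ProductBernoulli.
Context (R : realType) (G : finType) (q : G -> R).
Hypothesis q01 : forall v, 0 <= q v <= 1.

Definition bern_weight (y : {ffun G -> bool}) : R :=
  \prod_v (if y v then q v else 1 - q v).

Definition bern_mean (u : {ffun G -> bool} -> R) : R := \sum_y bern_weight y * u y.

Lemma bern_weight_ge0 y : 0 <= bern_weight y.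
Proof. by apply: prodr_ge0 => v _; have := q01 v; case: (y v); lra. Qed.

(** The form in which the independence of the coordinates is used. *)
Lemma bern_mean_prod (h : G -> bool -> R) :
  bern_mean (fun y => \prod_v h v (y v)) =
    \prod_v (q v * h v true + (1 - q v) * h v false).
Proof.
under [RHS]eq_bigr => v _.
  rewrite (_ : _ + _ = \sum_b (if b then q v else 1 - q v) * h v b).
    over.
  by rewrite big_bool.
by rewrite bigA_distr_bigA; apply: eq_bigr => y _; rewrite -big_split.
Qed.

Lemma bern_mean_cst c : bern_mean (fun=> c) = c.
Proof.
rewrite /bern_mean -mulr_suml.
suff -> : \sum_y bern_weight y = 1 by rewrite mul1r.
transitivity (bern_mean (fun y => \prod_v (fun _ _ => 1) v (y v))).
  by apply: eq_bigr => y _; rewrite big1_eq mulr1.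
by rewrite (bern_mean_prod (fun _ _ => 1)) big1 // => v _; ring.
Qed.

Lemma eq_bern_mean u u' : u =1 u' -> bern_mean u = bern_mean u'.
Proof. by move=> uu'; apply: eq_bigr => y _; rewrite uu'. Qed.

Lemma bern_meanD u u' : bern_mean (fun y => u y + u' y) = bern_mean u + bern_mean u'.
Proof. by rewrite -big_split; apply: eq_bigr => y _; rewrite mulrDr. Qed.

Lemma bern_meanZ c u : bern_mean (fun y => c * u y) = c * bern_mean u.
Proof. by rewrite [RHS]mulr_sumr; apply: eq_bigr => y _; rewrite mulrCA. Qed.

Lemma bern_mean_sum (I : Type) (r : seq I) (P : pred I) F :
  bern_mean (fun y => \sum_(i <- r | P i) F i y) = \sum_(i <- r | P i) bern_mean (F i).
Proof. by rewrite exchange_big; apply: eq_bigr => y _; rewrite mulr_sumr. Qed.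

Lemma ler_bern_mean u u' : (forall y, u y <= u' y) -> bern_mean u <= bern_mean u'.
Proof. by move=> uu'; apply: ler_sum => y _; rewrite ler_wpM2l ?bern_weight_ge0. Qed.

Lemma norm_bern_mean u : `|bern_mean u| <= bern_mean (fun y => `|u y|).
Proof.
rewrite (le_trans (ler_norm_sum _ _ _)) //; apply: ler_sum => y _.
by rewrite normrM ger0_norm ?bern_weight_ge0.
Qed.

Let dev v (y : {ffun G -> bool}) : R := (y v)%:R - q v.

Lemma bern_mean_dev v : bern_mean (dev v) = 0.
Proof.
transitivity (bern_mean (fun y => \prod_w (if w == v then (y w)%:R - q w else 1))).
  by apply: eq_bern_mean => y; rewrite -big_mkcond big_pred1_eq.
rewrite (bern_mean_prod (fun w b => if w == v then b%:R - q w else 1)).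
rewrite (bigD1 v) //= eqxx.
by apply/eqP; rewrite mulf_eq0; apply/orP; left; apply/eqP; ring.
Qed.

Lemma bern_mean_dev2 v w : v != w -> bern_mean (fun y => dev v y * dev w y) = 0.
Proof.
move=> vw.
pose h u (b : bool) : R := if (u == v) || (u == w) then b%:R - q u else 1.
transitivity (bern_mean (fun y => \prod_u h u (y u))).
  apply: eq_bern_mean => y; rewrite (bigD1 v) //= (bigD1 w) /=; last by rewrite eq_sym.
  rewrite big1 ?mulr1; first by rewrite /h !eqxx orbT.
  by move=> u /andP[/negPf uv /negPf uw]; rewrite /h uv uw.
rewrite bern_mean_prod (bigD1 v) //= /h eqxx /=.
by apply/eqP; rewrite mulf_eq0; apply/orP; left; apply/eqP; ring.
Qed.

(** The terms are centred, uncorrelated and bounded by 1, so the second moment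
    of the sum is at most the number of terms. *)
Lemma bern_mean_abs_sum (A : {set G}) (c : G -> R) : (forall v, `|c v| <= 1) ->
  bern_mean (fun y => `|\sum_(v in A) c v * dev v y|) <= Num.sqrt #|A|%:R.
Proof.
move=> c1.
have [/cards0_eq->|A0] := eqVneq #|A| 0%N.
  by under eq_bern_mean do rewrite big_set0 normr0; rewrite bern_mean_cst sqrtr_ge0.
have s0 : 0 < Num.sqrt #|A|%:R :> R by rewrite sqrtr_gt0 ltr0n lt0n.
set s := Num.sqrt _ in s0 *.
have ss : s ^+ 2 = #|A|%:R by rewrite sqr_sqrtr.
set S := fun y => \sum_(v in A) c v * dev v y.
have var : bern_mean (fun y => S y ^+ 2) <= #|A|%:R.
  under eq_bern_mean do rewrite expr2 {1}/S mulr_suml.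
  rewrite bern_mean_sum -sum1_card natr_sum; apply: ler_sum => v vA.
  have -> : bern_mean (fun y => c v * dev v y * S y) =
            bern_mean (fun y => c v ^+ 2 * dev v y ^+ 2).
    under eq_bern_mean do rewrite /S (bigD1 v) //= mulrDr.
    rewrite bern_meanD -[RHS]addr0; congr (_ + _).
      by apply: eq_bern_mean => y; ring.
    under eq_bern_mean do rewrite mulr_sumr.
    rewrite bern_mean_sum big1 // => w /andP[_ wv].
    transitivity (bern_mean (fun y => c v * c w * (dev v y * dev w y))).
      by apply: eq_bern_mean => y; ring.
    by rewrite bern_meanZ bern_mean_dev2 ?mulr0 // eq_sym.
  rewrite -[leRHS](bern_mean_cst 1%:R); apply: ler_bern_mean => y.
  rewrite -exprMn -[leLHS]ger0_norm ?sqr_ge0 // normrX expr_le1 //.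
  rewrite normrM mulr_ile1 // /dev ler_norml; have := q01 v.
  by case: (y v) => /=; lra.
(* The first moment is controlled by the second through
   2 |S| <= S^2 / s + s, which is an equality at |S| = s. *)
have -> : s = (s^-1 * #|A|%:R + s) / 2.
  by rewrite -ss; field; rewrite gt_eqF.
have : bern_mean (fun y => `|S y|) <= bern_mean (fun y => (s^-1 * S y ^+ 2 + s) / 2).
  apply: ler_bern_mean => y; rewrite ler_pdivlMr //.
  have -> : s^-1 * S y ^+ 2 + s = `|S y| * 2 + s^-1 * (`|S y| - s) ^+ 2.
    by rewrite -(real_normK (num_real (S y))); field; rewrite gt_eqF.
  by rewrite lerDl mulr_ge0 ?sqr_ge0 // invr_ge0 ltW.
move/le_trans; apply.
under eq_bern_mean do rewrite mulrC.
rewrite bern_meanZ bern_meanD bern_meanZ bern_mean_cst [leRHS]mulrC.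
by rewrite ler_wpM2l // lerD2r ler_wpM2l // invr_ge0 ltW.
Qed.

End ProductBernoulli.

(** * The deterministic flow from a product measure *)

Section MeanFieldStep.
Context (R : realType) (M : R) (f g : R -> R).
Hypothesis f01 : forall y : R, 0 <= y <= 1 -> 0 <= f y <= 1.
Hypothesis g01 : forall y : R, 0 <= y <= 1 -> 0 <= g y <= 1.
Hypothesis f_lip : forall y z : R,
  0 <= y <= 1 -> 0 <= z <= 1 -> `|f y - f z| <= M * `|y - z|.
Hypothesis g_lip : forall y z : R,
  0 <= y <= 1 -> 0 <= z <= 1 -> `|g y - g z| <= M * `|y - z|.

Lemma lip_const_ge0 : 0 <= M.
Proof.
have := @f_lip 0 1; rewrite !lexx !ler01 sub0r normrN1 mulr1 => /(_ isT isT).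
by apply: le_trans; apply: normr_ge0.
Qed.

Lemma gamma_itv01 x y : 0 <= x <= 1 -> 0 <= y <= 1 -> 0 <= gamma f g x y <= 1.
Proof. by move=> x01 y01; have := f01 y01; have := g01 y01; rewrite /gamma; nra. Qed.

(** gamma is affine in x with slope 1 - f y - g y, which lies in [-1, 1], and
    for fixed x it is a convex combination of 1 - f and g. *)
Lemma gamma_lip x x' y y' :
    0 <= x <= 1 -> 0 <= x' <= 1 -> 0 <= y <= 1 -> 0 <= y' <= 1 ->
  `|gamma f g x y - gamma f g x' y'| <= `|x - x'| + M * `|y - y'|.
Proof.
move=> x01 x'01 y01 y'01.
have -> : gamma f g x y - gamma f g x' y' =
    (x - x') * (1 - f y - g y) + ((1 - x') * (g y - g y') - x' * (f y - f y')).
  by rewrite /gamma; ring.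
rewrite (le_trans (ler_normD _ _)) // lerD //.
  rewrite normrM ler_piMr ?normr_ge0 // ler_norml.
  by have := f01 y01; have := g01 y01; lra.
have := f_lip y01 y'01; have := g_lip y01 y'01.
rewrite !ler_norml; set L := M * _; nra.
Qed.

Variable G : sgraph.
Local Notation flow := (det_process f g).

Lemma det_process_itv01 (q : G -> R) r v :
  (forall w, 0 <= q w <= 1) -> 0 <= flow q r v <= 1.
Proof.
move=> q01; elim: r v => [|r IH] v //=.
by apply: gamma_itv01 => //; apply: nbr_mean_itv01.
Qed.

Lemma det_processSr (q : G -> R) r : flow q r.+1 = flow (flow q 1) r.
Proof.
elim: r => [//|r IH].
by rewrite -[LHS]/(fun v => gamma f g (flow q r.+1 v) (nbr_mean (flow q r.+1) v)) IH.
Qed.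

Lemma realc_itv01 (y : config G) v : 0 <= realc R y v <= 1.
Proof. by rewrite /realc; case: (y v); rewrite ?lexx ?ler01. Qed.

Section FromProductMeasure.
Variable q : G -> R.
Hypothesis q01 : forall w, 0 <= q w <= 1.

Let drive r v := nbr_mean (flow q r) v.

(** The derivative of [driven] in the initial value at v: by the chain rule, the
    product of the slopes of the affine maps x |-> gamma x (drive i v). *)
Definition slope r v : R := \prod_(0 <= i < r) (1 - f (drive i v) - g (drive i v)).

(** The orbit at v of the initial value y v when its neighbourhood averages are
    those of the flow from q, in closed form; [drivenS] is its recursion. The
    closed form shows that it depends on y through y v only. *)
Definition driven (y : G -> R) r v : R := flow q r v + slope r v * (y v - q v).

Lemma drive_itv01 r v : 0 <= drive r v <= 1.
Proof. by apply: nbr_mean_itv01 => w; apply: det_process_itv01. Qed.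

Lemma norm_slope_le1 r v : `|slope r v| <= 1.
Proof.
rewrite /slope normr_prod prodr_ile1 // => i _; rewrite normr_ge0 ler_norml.
by have := f01 (drive_itv01 i v); have := g01 (drive_itv01 i v); lra.
Qed.

Lemma drivenS y r v : driven y r.+1 v = gamma f g (driven y r v) (drive r v).
Proof. by rewrite /driven /slope big_nat_recr //= /gamma -/(drive r v); ring. Qed.

Lemma driven_itv01 y r v : (forall w, 0 <= y w <= 1) -> 0 <= driven y r v <= 1.
Proof.
move=> y01; elim: r => [|r IH].
  by rewrite /driven /slope big_geq // mul1r /= addrC subrK.
by rewrite drivenS gamma_itv01 ?drive_itv01.
Qed.

(** The neighbourhood average of the flow from y differs from [drive] by the
    average of flow - driven and by that of driven - flow from q; the second is
    an average of multiples of the y w - q w. *)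
Lemma flow_driven_dist y r v : (forall w, 0 <= y w <= 1) ->
  `|flow y r.+1 v - driven y r.+1 v| <=
    `|flow y r v - driven y r v| +
    M * (nbr_mean (fun w => `|flow y r w - driven y r w|) v +
         (deg v)%:R^-1 * `|\sum_(w in nbr v) slope r w * (y w - q w)|).
Proof.
move=> y01; rewrite drivenS /=.
have nm01 : 0 <= nbr_mean (flow y r) v <= 1.
  by apply: nbr_mean_itv01 => w; apply: det_process_itv01.
rewrite (le_trans (gamma_lip _ _ _ _)) ?driven_itv01 ?drive_itv01 ?det_process_itv01 //.
rewrite lerD2l ler_wpM2l ?lip_const_ge0 //.
have -> : nbr_mean (flow y r) v - drive r v =
    nbr_mean (fun w => flow y r w - driven y r w) v +
    (deg v)%:R^-1 * \sum_(w in nbr v) slope r w * (y w - q w).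
  rewrite /drive nbr_meanB /nbr_mean -mulrDr -big_split /=; congr (_ * _).
  by apply: eq_bigr => w _; rewrite /driven; ring.
rewrite (le_trans (ler_normD _ _)) // lerD ?nbr_mean_norm //.
by rewrite normrM ger0_norm // invr_ge0.
Qed.

(** The mean of [flow_driven_dist] is a recursive inequality whose equality case
    is [fluctS]; the square root of the degree comes from
    [bern_mean_abs_sum]. *)
Lemma bern_mean_flow_driven r v :
  bern_mean q (fun y => `|flow (realc R y) r v - driven (realc R y) r v|) <= fluct M r v.
Proof.
elim: r v => [|r IH] v.
  rewrite /fluct big_geq // -[leRHS](bern_mean_cst q 0); apply: ler_bern_mean => // y.
  by rewrite /driven /slope big_geq //= (_ : _ - _ = 0) ?normr0 //; ring.
have step := ler_bern_mean q01 (fun y => flow_driven_dist r v (realc_itv01 y)).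
apply: (le_trans step); rewrite bern_meanD bern_meanZ bern_meanD fluctS.
apply: lerD => //; apply: ler_wpM2l; first exact: lip_const_ge0.
apply: lerD.
  pose F (y : config G) w : R := `|flow (realc R y) r w - driven (realc R y) r w|.
  rewrite (_ : bern_mean _ _ = nbr_mean (fun w => bern_mean q (F^~ w)) v).
    by apply: nbr_mean_mono => w; apply: IH.
  by rewrite /bern_mean nbr_mean_sum.
rewrite bern_meanZ; have d0 : 0 <= (deg v)%:R^-1 :> R by rewrite invr_ge0.
apply: (le_trans (ler_wpM2l d0 (bern_mean_abs_sum q01 (nbr v) (norm_slope_le1 r)))).
rewrite -/(deg v); have [->|dv] := eqVneq (deg v) 0%N.
  by rewrite sqrtr0 invr0 mul0r.
rewrite -[X in X^-1 * _](@sqr_sqrtr _ (deg v)%:R) // expr2 invfM mulfVK //.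
by rewrite sqrtr_eq0 -ltNge ltr0n lt0n.
Qed.

Lemma bern_mean_driven r v : bern_mean q (fun y => driven (realc R y) r v) = flow q r v.
Proof.
by rewrite /driven bern_meanD bern_mean_cst bern_meanZ bern_mean_dev mulr0 addr0.
Qed.

(** The driven orbits have the same mean as the flow from q, so only their
    distance to the flow contributes to the bias. *)
Lemma bern_mean_flow_le r v :
  `|bern_mean q (fun y => flow (realc R y) r v) - flow q r v| <= fluct M r v.
Proof.
rewrite -bern_mean_driven -sumrB.
apply: le_trans (bern_mean_flow_driven r v).
rewrite -[X in `|X|](@eq_bigr _ _ _ _ _ _ (fun y => bern_weight q y *
  (flow (realc R y) r v - driven (realc R y) r v))); first exact: norm_bern_mean.
by move=> y _; rewrite mulrBr.
Qed.

End FromProductMeasure.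

(** * Interpolation between the chain and the flow *)

Section Chain.
Variables (p : nat -> config G -> R) (x0 : config G).
Hypothesis p_ge0 : forall t x, 0 <= p t x.
Hypothesis sum_p : forall t, \sum_x p t x = 1.
Hypothesis p0 : p 0 x0 = 1.
Hypothesis pS : forall t y,
  p t.+1 y = \sum_x p t x * bern_weight (flow (realc R x) 1) y.

(** Lowering k while raising r leads from the mean of the chain, at r = 0, to the
    flow from x0, at k = 0. *)
Let interp v k r := \sum_x p k x * flow (realc R x) r v.

Lemma interp_start v r : interp v 0 r = flow (realc R x0) r v.
Proof.
have /eqP := sum_p 0; rewrite (bigD1 x0) //= p0 -subr_eq0 addrAC subrr add0r => /eqP s0.
rewrite /interp (bigD1 x0) //= p0 mul1r big1 ?addr0 // => x xx0.
by rewrite (psumr_eq0P _ s0) ?mul0r.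
Qed.

(** The chain moves from x to a product measure with mean the image of x under
    the flow, which is the situation of [bern_mean_flow_le]. *)
Lemma interp_step v k r : `|interp v k.+1 r - interp v k r.+1| <= fluct M r v.
Proof.
have -> : interp v k.+1 r - interp v k r.+1 = \sum_x p k x *
   (bern_mean (flow (realc R x) 1) (fun y => flow (realc R y) r v)
     - flow (flow (realc R x) 1) r v).
  rewrite /interp; under eq_bigr do rewrite pS mulr_suml.
  rewrite exchange_big -sumrB; apply: eq_bigr => x _ /=.
  rewrite mulrBr -det_processSr; congr (_ - _).
  by rewrite /bern_mean mulr_sumr; apply: eq_bigr => y _; rewrite mulrA.
apply: (le_trans (ler_norm_sum _ _ _)).
rewrite -[leRHS]mul1r -(sum_p k) mulr_suml; apply: ler_sum => x _.
rewrite normrM ger0_norm // ler_wpM2l // bern_mean_flow_le // => w.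
by apply: det_process_itv01 => ?; apply: realc_itv01.
Qed.

Lemma chain_mean_dist v t :
  `|(\sum_x p t x * (x v)%:R) - flow (realc R x0) t v| <= \sum_(0 <= r < t) fluct M r v.
Proof.
suff H k r : `|interp v k r - interp v 0 (k + r)| <= \sum_(r <= i < k + r) fluct M i v.
  by have := H t 0%N; rewrite addn0 interp_start.
elim: k r => [|k IH] r; first by rewrite subrr normr0 big_geq.
rewrite (le_trans (ler_distD (interp v k r.+1) _ _)) // addSnnS big_ltn ?leq_addl //.
by rewrite lerD ?interp_step ?IH.
Qed.

End Chain.
End MeanFieldStep.

(** * The law of the occupancy process *)

Lemma fsbig_setT_finType (R : realType) (T : finType) (F : T -> \bar R) :
  (\sum_(x \in [set: T]) F x = \sum_x F x)%E.
Proof.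
rewrite fsbig_finite //=.
apply: perm_big; apply: uniq_perm; rewrite ?index_enum_uniq ?finmap.fset_uniq // => x.
by rewrite mem_index_enum in_fset_set ?in_setT; last exact: finite_finset.
Qed.

Section Law.
Context {d : measure_display} {Omega : measurableType d} {R : realType}.
Variable P : probability Omega R.
Variable G : sgraph.
Variable X : nat -> G -> {RV P >-> bool}.

Lemma measurable_at_vertex t v b : measurable (at_vertex X t v b).
Proof.
rewrite (_ : at_vertex X t v b = X t v @^-1` [set b]) //.
exact: measurable_funPTI.
Qed.

Lemma at_configE t x : at_config X t x = \bigcap_v at_vertex X t v (x v).
Proof. by apply/seteqP; split => w /= H v; [move=> _|]; apply: H. Qed.

Lemma measurable_at_config t x : measurable (at_config X t x).
Proof.
rewrite at_configE; apply: fin_bigcap_measurable; first exact: finite_finset.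
by move=> v _; apply: measurable_at_vertex.
Qed.

Lemma fine_prob_total t A : measurable A ->
  fine (P A) = \sum_x fine (P (A `&` at_config X t x)).
Proof.
move=> mA.
have mAx x : measurable (A `&` at_config X t x).
  by apply: measurableI => //; apply: measurable_at_config.
have {1}-> : A = \bigcup_x (A `&` at_config X t x).
  apply/seteqP; split => [w Aw|w [x _ []]//].
  by exists [ffun v => X t v w] => //; split=> // v; rewrite ffunE.
rewrite measure_fin_bigcup //=; first last.
- apply/trivIsetP => x y _ _ xy; apply/seteqP; split=> // w [[_ wx] [_ wy]].
  by move/eqP: xy; apply; apply/ffunP => v; rewrite -wx -wy.
rewrite fsbig_setT_finType.
have PE x : P (A `&` at_config X t x) = (fine (P (A `&` at_config X t x)))%:E.
  by rewrite fineK // fin_num_measure.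
by rewrite (eq_bigr _ (fun x _ => PE x)) sumEFin.
Qed.

Definition config_prob t (x : config G) : R := fine (P (at_config X t x)).

Lemma config_prob_ge0 t x : 0 <= config_prob t x.
Proof. by rewrite fine_ge0. Qed.

Lemma sum_config_prob t : \sum_x config_prob t x = 1.
Proof.
have := fine_prob_total t measurableT; rewrite probability_setT /= => ->.
by apply: eq_bigr => x _; rewrite setTI.
Qed.

Lemma mean_occE t v : mean_occ X t v = (\sum_x config_prob t x * (x v)%:R)%:E.
Proof.
have mA : measurable (at_vertex X t v true) by exact: measurable_at_vertex.
rewrite /mean_occ (_ : (fun w => _) = \1_(at_vertex X t v true)); last first.
  apply/funext => w; rewrite indicE.
  by case E: (X t v w); [rewrite mem_set|rewrite memNset //= /at_vertex /= E].
rewrite expectation_indic // -[LHS]fineK ?fin_num_measure //.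
congr (_%:E); rewrite (fine_prob_total t mA); apply: eq_bigr => x _.
case xv: (x v); rewrite ?mulr1 ?mulr0.
  congr (fine (P _)); apply/seteqP; split=> [w []//|w Hw]; split=> //.
  by rewrite /at_vertex /= Hw.
rewrite (_ : _ `&` _ = set0) ?measure0 //; apply/seteqP; split=> // w [/= vt Hw].
by have := Hw v; rewrite xv vt.
Qed.

Lemma cond_prob_vertexC t x v b : P (at_config X t x) != 0%E ->
  cond_prob P (at_vertex X t.+1 v b) (at_config X t x) =
  1 - cond_prob P (at_vertex X t.+1 v (~~ b)) (at_config X t x).
Proof.
move=> Px; have mx := measurable_at_config t x.
have Px0 : fine (P (at_config X t x)) != 0.
  by rewrite fine_eq0 // fin_num_measure.
apply/eqP; rewrite eq_sym subr_eq eq_sym /cond_prob -mulrDl.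
have <- : fine (P (at_config X t x)) =
   fine (P (at_vertex X t.+1 v b `&` at_config X t x)) +
   fine (P (at_vertex X t.+1 v (~~ b) `&` at_config X t x)).
  rewrite -fineD ?fin_num_measure //; first last.
  - by apply: measurableI => //; apply: measurable_at_vertex.
  - by apply: measurableI => //; apply: measurable_at_vertex.
  rewrite -measureU //; first last.
  - by apply/seteqP; split=> // w [[e _] [e' _]]; have := etrans (esym e) e'; case: (b).
  - by apply: measurableI => //; apply: measurable_at_vertex.
  - by apply: measurableI => //; apply: measurable_at_vertex.
  congr (fine (P _)); rewrite -setIUl; apply/seteqP; split=> [w Hw|w []//].
  by split=> //; rewrite /at_vertex /=; case: (X _ _ w) (b) => -[]; by [left|right].
by rewrite divff.
Qed.

(** Conditional independence of all updates makes the law of X(t+1) given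
    X(t) = x a product measure, and the switching probabilities identify its
    marginals with the deterministic step from x. *)
Lemma config_probS (f g : R -> R) t y : occupancy_process X f g ->
  config_prob t.+1 y =
  \sum_x config_prob t x * bern_weight (det_process f g (realc R x) 1) y.
Proof.
move=> [_ sw ci]; rewrite {1}/config_prob (fine_prob_total t (measurable_at_config _ _)).
apply: eq_bigr => x _; rewrite /config_prob.
have [Px|Px] := eqVneq (P (at_config X t x)) 0%E.
  (* Configurations of probability zero have no conditional law, but both sides
     vanish there. *)
  rewrite Px mul0r (_ : P _ = 0%E) //; apply/eqP; rewrite eq_le measure_ge0 andbT -Px.
  by apply: le_measure; rewrite ?inE;
    [apply: measurableI; exact: measurable_at_config|exact: measurable_at_config|].
have Px0 : fine (P (at_config X t x)) != 0.
  by rewrite fine_eq0 // fin_num_measure //; apply: measurable_at_config.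
have := ci t x Px [set: G]%SET y.
rewrite (_ : [set w | _] = at_config X t.+1 y); last first.
  by apply/seteqP; split => w /= H v; [apply: H; rewrite inE|move=> _; apply: H].
move=> cy; rewrite mulrC -[LHS](divfK Px0) -/(cond_prob _ _ _) cy; congr (_ * _).
rewrite /bern_weight; under eq_bigl do rewrite inE.
apply: eq_bigr => v _; have [sw1 sw0] := sw t x Px v.
rewrite /= /gamma; have -> : realc R x v = (x v)%:R by [].
case: (y v); case xv: (x v) => /=.
- by rewrite cond_prob_vertexC // sw1 //; ring.
- by rewrite sw0 //; ring.
- by rewrite sw1 //; ring.
- by rewrite cond_prob_vertexC // sw0 //; ring.
Qed.

End Law.

(** * The mean-field bound *)

Section MeanFieldBound.
Context (R : realType) (M : R) (f g : R -> R).
Hypothesis f01 : set_fun `[0, 1] `[0, 1] f.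
Hypothesis g01 : set_fun `[0, 1] `[0, 1] g.
Hypothesis f_lip : M.-lipschitz_(`[0, 1]) f.
Hypothesis g_lip : M.-lipschitz_(`[0, 1]) g.

Lemma set_fun_itv01 (h : R -> R) : set_fun `[0, 1] `[0, 1] h ->
  forall y : R, 0 <= y <= 1 -> 0 <= h y <= 1.
Proof. by move=> h01 y y01; have := h01 y; rewrite /= !in_itv /=; apply. Qed.

Lemma lipschitz_itv01 (h : R -> R) : M.-lipschitz_(`[0, 1]) h ->
  forall y z : R, 0 <= y <= 1 -> 0 <= z <= 1 -> `|h y - h z| <= M * `|y - z|.
Proof.
by move=> hl y z y01 z01; have := hl (y, z); apply; split; rewrite /= in_itv.
Qed.

Variables (G : sgraph) (x0 : config G).
Context (d : measure_display) (Omega : measurableType d) (P : probability Omega R).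
Variable X : nat -> G -> {RV P >-> bool}.

Lemma mean_occ_dist v t : occupancy_process X f g -> P (at_config X 0 x0) = 1%E ->
  (`| mean_occ X t v - (det_process f g (realc R x0) t v)%:E | <=
   (\sum_(0 <= r < t) fluct M r v)%:E)%E.
Proof.
move=> oX X0; rewrite mean_occE -EFinB lee_fin.
apply: (@chain_mean_dist _ _ _ _ (set_fun_itv01 f01) (set_fun_itv01 g01)
   (lipschitz_itv01 f_lip) (lipschitz_itv01 g_lip)).
- exact: config_prob_ge0.
- exact: sum_config_prob.
- by rewrite /config_prob X0.
- by move=> s y; apply: config_probS.
Qed.

End MeanFieldBound.

Theorem corollary1 (R : realType) (M : R) (f g : R -> R)
  (f01 : set_fun `[0, 1] `[0, 1] f) (g01 : set_fun `[0, 1] `[0, 1] g)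
  (f_lip : M.-lipschitz_(`[0, 1]) f) (g_lip : M.-lipschitz_(`[0, 1]) g) :
  (forall (G : sgraph) (x0 : config G)
      (d : measure_display) (Omega : measurableType d)
      (P : probability Omega R) (X : nat -> G -> {RV P >-> bool}),
    no_isolated G ->
    occupancy_process X f g ->
    P (at_config X 0 x0) = 1%E ->
    forall (v : G) (t : nat),
      (`| mean_occ X t v - (det_process f g (realc R x0) t v)%:E | <=
       (\sum_(0 <= r < t) \sum_(0 <= s < r)
          'C(r, s.+1)%:R *
          (\sum_(w : G) walk_prob R v w s / Num.sqrt (deg w)%:R) *
          M ^+ s.+1)%:E)%E)
  /\
  (forall (t : nat) (eps : R), 0 < eps ->
    exists D : nat,
    forall (G : sgraph) (x0 : config G)
      (d : measure_display) (Omega : measurableType d)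
      (P : probability Omega R) (X : nat -> G -> {RV P >-> bool}),
    (D <= min_deg G)%N ->
    occupancy_process X f g ->
    P (at_config X 0 x0) = 1%E ->
    forall v : G,
      (`| mean_occ X t v - (det_process f g (realc R x0) t v)%:E | <=
       eps%:E)%E).
Proof.
split=> [G x0 d Omega P X _ oX X0 v t|t eps eps0].
  exact: mean_occ_dist.
have M0 : 0 <= M by apply: lip_const_ge0 (lipschitz_itv01 f_lip).
pose K : R := \sum_(0 <= r < t) \sum_(0 <= s < r) 'C(r, s.+1)%:R * M ^+ s.+1.
have K0 : 0 <= K.
  by do 2!apply: sumr_ge0 => ? _; rewrite mulr_ge0 ?exprn_ge0.
(* This D makes K / sqrt D at most eps. *)
pose D := (Num.trunc ((K / eps) ^+ 2)).+1.
have DK : (K / eps) ^+ 2 < D%:R by apply: truncnS_gt.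
exists D => G x0 d Omega P X /min_degP[_ Ddeg] oX X0 v.
apply: (le_trans (mean_occ_dist f01 g01 f_lip g_lip v t oX X0)); rewrite lee_fin.
pose c : R := (Num.sqrt D%:R)^-1.
have sD : 0 < Num.sqrt D%:R :> R by rewrite sqrtr_gt0 ltr0n.
have c0 : 0 <= c by rewrite invr_ge0 ltW.
apply: (@le_trans _ _ (K * c)).
  rewrite /K mulr_suml; apply: ler_sum => r _.
  rewrite /fluct mulr_suml; apply: ler_sum => s _.
  rewrite mulrAC ler_wpM2l ?mulr_ge0 ?exprn_ge0 //.
  apply: walk_mean_le => // w.
  rewrite /c lef_pV2 ?posrE // ?ler_wsqrtr ?ler_nat //.
  by rewrite sqrtr_gt0 ltr0n (leq_trans _ (Ddeg w)).
rewrite /c ler_pdivrMr // mulrC -ler_pdivrMr //.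
rewrite -[leLHS]ger0_norm ?divr_ge0 ?(ltW eps0) // -sqrtr_sqr.
by rewrite ler_wsqrtr // ltW.
Qed.
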